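(* Let $d\geq 4$ and consider an ontological model that reproduces the quantum predictions for a quantum system with Hilbert space $\mathbb{C}^d$. Suppose that there is a constant $k$ such that \[ \omega_C(\mu_\psi,\mu_\phi) \geq k\,\omega_Q(\psi,\phi)\quad\text{for all pure states } \ket{\psi},\ket{\phi}. \] Then $k < 4/(d-1)$. If moreover $d$ is a prime power, then $k < 2/d$.
   Context: An ontological model for a quantum system with Hilbert space $\mathbb{C}^d$ consists of: a measure space $\Lambda$ of ''ontic states'' (with measure $\mathrm{d}\lambda$); for every pure state $\ket{\psi}$, an epistemic state $\mu_\psi$, i.e. a probability density on $\Lambda$ ($\mu_\psi(\lambda)\geq 0$, $\int_\Lambda \mu_\psi(\lambda)\,\mathrm{d}\lambda=1$); and for every projective measurement $M$ with outcomes $f$ (corresponding to orthogonal projectors $P_f$ summing to the identity), response functions $\xi_M(f|\lambda)\geq 0$ with $\sum_f \xi_M(f|\lambda)=1$ for all $\lambda$. The model reproduces the quantum predictions if $\int_\Lambda \xi_M(f|\lambda)\mu_\psi(\lambda)\,\mathrm{d}\lambda = \bra{\psi}P_f\ket{\psi}$ for all pure states $\ket{\psi}$, all projective measurements $M$ and outcomes $f$ (for a rank-one outcome $P_f=\ket{f}\bra{f}$ this is $|\braket{f|\psi}|^2$). The classical overlap of probability densities $p,q$ is $\omega_C(p,q)=\int \min\{p(x),q(x)\}\,\mathrm{d}x$. The quantum overlap of pure states is $\omega_Q(\psi,\phi)=1-\sqrt{1-|\braket{\psi|\phi}|^2}$. *)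

(* Defs.v *)
From HB Require Import structures.
From mathcomp Require Import all_boot all_order all_algebra.
From mathcomp Require Import all_classical all_reals.
From mathcomp Require Import ereal measure lebesgue_measure lebesgue_integral.
From mathcomp Require Import complex.
Set Implicit Arguments. Unset Strict Implicit. Unset Printing Implicit Defensive.
Import Order.TTheory GRing.Theory Num.Theory.
Local Open Scope ring_scope.

Section Quantum.
Variables (R : realType) (d : nat).
Local Notation C := (R[i]).

Definition ket := 'cV[C]_d.

Definition braket (psi phi : ket) : C :=
  \sum_(i < d) conjc (psi i 0) * phi i 0.

Definition sqmod (z : C) : R := (complex.Re z) ^+ 2 + (complex.Im z) ^+ 2.

Definition pure_state (psi : ket) : Prop := braket psi psi = 1.

Definition adj (A : 'M[C]_d) : 'M[C]_d := (map_mx conjc A)^T.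

Definition orth_projector (P : 'M[C]_d) : Prop := adj P = P /\ P *m P = P.

Record proj_meas := ProjMeas {
  pm_n : nat;
  pm_P : 'I_pm_n -> 'M[C]_d;
  pm_proj : forall f, orth_projector (pm_P f);
  pm_sum : \sum_(f < pm_n) pm_P f = 1%:M }.

(* <psi| P |psi> (real part; it is real since P is hermitian) *)
Definition qprob (P : 'M[C]_d) (psi : ket) : R :=
  complex.Re (((map_mx conjc psi)^T *m P *m psi) 0 0).

Definition omegaQ (psi phi : ket) : R :=
  1 - Num.sqrt (1 - sqmod (braket psi phi)).

End Quantum.

Section Ontological.
Context {R : realType} {d0 : measure_display} {T : measurableType d0}.
Variable (lam : {measure set T -> \bar R}).
Local Open Scope ereal_scope.

Definition is_density (p : T -> R) : Prop :=
  measurable_fun setT p /\ (forall x, (0 <= p x)%R) /\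
  \int[lam]_x (p x)%:E = 1.

Definition omegaC (p q : T -> R) : \bar R :=
  \int[lam]_x (Num.min (p x) (q x))%:E.

Definition reproduces_QM (d : nat) (mu : ket R d -> T -> R)
  (xi : forall M : proj_meas R d, 'I_(pm_n M) -> T -> R) : Prop :=
  (forall psi, pure_state psi -> is_density (mu psi)) /\
  (forall M f, measurable_fun setT (xi M f)) /\
  (forall M f x, (0 <= xi M f x)%R) /\
  (forall M x, (\sum_(f < pm_n M) xi M f x = 1)%R) /\
  (forall M f psi, pure_state psi ->
     \int[lam]_x (xi M f x * mu psi x)%:E = (qprob (pm_P f) psi)%:E).

End Ontological.

(* Main.v *)
(* If [psi], [a], [b] admit a measurement each of whose outcomes has probability
   zero in one of the three states, then [min (mu psi, mu a, mu b)] integrates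
   to zero.  Hence, for states [e_i] such that every triple [psi, e_i, e_j] is of
   this kind, the functions [min (mu psi, mu e_i)] have almost disjoint supports
   and [sum_i omegaC (mu psi) (mu e_i) <= 1].

   For a prime power [q >= 4], [q <= d], let [psi] be a vector of the standard
   basis of a copy of C^q, and let the [e_i] be the [q^2] vectors of [q] further
   mutually unbiased bases: with coordinates indexed by the field F_q, they are
   [e_(a,b) x = f_a x * chi (b x) / sqrt q], where [chi] is a nontrivial additive
   character and [f_a (x + y) = f_a x * f_a y * chi (a x y)].  All squared overlaps of distinct vectors are [0] or
   [1/q], so the triples are of the above kind by the criterion of Caves, Fuchs
   and Schack, and [k q^2 (1 - sqrt (1 - 1/q)) <= 1], whence [k < 2/q].  The
   general bound takes for [q] the largest power of 2 that is at most [d]. *)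

Require Import Defs.
From HB Require Import structures.
From mathcomp Require Import all_boot all_order all_algebra.
From mathcomp Require Import all_classical all_reals.
From mathcomp Require Import ereal measure lebesgue_measure lebesgue_integral.
From mathcomp Require Import complex.
From mathcomp Require Import measurable_realfun vector falgebra finfield zify ring lra.
Import Order.TTheory GRing.Theory Num.Theory.
Local Open Scope ring_scope.

Set Implicit Arguments. Unset Strict Implicit.

(** Conclusive exclusion, or post-Peierls incompatibility, restricted to projective measurements;
    several outcomes may rule out the same state. *)
Definition antidistinguishable (R : realType) (d : nat) (psi a b : ket R d) : Prop :=
  exists M : proj_meas R d, forall f : 'I_(pm_n M),
    qprob (pm_P f) psi = 0 \/ qprob (pm_P f) a = 0 \/ qprob (pm_P f) b = 0.

(** * The Hermitian inner product, and a Thales point with prescribed overlaps *)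

Section Braket.
Variables (R : realType) (d : nat).
Local Notation C := (R[i]).
Implicit Types (u v w g psi a b : ket R d) (c : C).

Lemma sqmodE (z : C) : conjc z * z = (sqmod z)%:C%C.
Proof. by rewrite mulrC -sqr_normc -add_Re2_Im2. Qed.

Lemma sqmod_ge0 (z : C) : 0 <= sqmod z.
Proof. by rewrite addr_ge0 ?sqr_ge0. Qed.

Lemma sqmod_conjc (z : C) : sqmod (conjc z) = sqmod z.
Proof. by case: z => x y; rewrite /sqmod /= sqrrN. Qed.

Lemma sqmodM (x y : C) : sqmod (x * y) = sqmod x * sqmod y.
Proof. by case: x => a b; case: y => e f; rewrite /sqmod /=; ring. Qed.

Lemma braketC u v : conjc (braket u v) = braket v u.
Proof.
rewrite /braket rmorph_sum; apply: eq_bigr => i _.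
by rewrite rmorphM /= conjcK mulrC.
Qed.

Lemma braketDr u v w : braket u (v + w) = braket u v + braket u w.
Proof. by rewrite /braket -big_split; apply: eq_bigr => i _; rewrite mxE mulrDr. Qed.

Lemma braketZr c u v : braket u (c *: v) = c * braket u v.
Proof. by rewrite /braket mulr_sumr; apply: eq_bigr => i _; rewrite mxE mulrCA. Qed.

Lemma braketDl u v w : braket (u + v) w = braket u w + braket v w.
Proof. by rewrite -braketC braketDr rmorphD /= !braketC. Qed.

Lemma braketZl c u v : braket (c *: u) v = conjc c * braket u v.
Proof. by rewrite -braketC braketZr rmorphM /= !braketC. Qed.

Lemma braketBr u v w : braket u (v - w) = braket u v - braket u w.
Proof. by rewrite -scaleN1r braketDr braketZr mulN1r. Qed.

Lemma braket_mxE u v : braket u v = ((map_mx conjc u)^T *m v) 0 0.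
Proof. by rewrite mxE; apply: eq_bigr => i _; rewrite !mxE. Qed.

Lemma braket_ge0 u : 0 <= braket u u.
Proof. by apply: sumr_ge0 => i _; rewrite mulrC mulcJ_ge0. Qed.

Lemma braket_eq0 u : (braket u u == 0) = (u == 0).
Proof.
apply/idP/eqP => [|->]; last first.
  by rewrite /braket big1 // => i _; rewrite mxE mulr0.
rewrite psumr_eq0 => [/allP u0|i _]; last by rewrite mulrC mulcJ_ge0.
apply/matrixP => i j; rewrite ord1 mxE.
have := u0 i (mem_index_enum i).
by rewrite mulf_eq0 conjc_eq0 orbb => /eqP.
Qed.

(** Fewer than [d] linear equations in [d] unknowns have a nonzero solution. It is normalised by the
    square root [n] of its squared norm, which is real and hence self-conjugate. *)
Lemma exists_orthogonal_unit m (A : 'M[C]_(m, d)) :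
  (m < d)%N -> exists u, braket u u = 1 /\ A *m u = 0.
Proof.
move=> md.
have : kermx A^T != 0.
  by rewrite -mxrank_eq0 mxrank_ker -lt0n subn_gt0 (leq_ltn_trans (rank_leq_col _)).
case/rowV0Pn => v /sub_kermxP vA vn0.
have Av : A *m v^T = 0 by rewrite -[A]trmxK -trmx_mul vA trmx0.
have vT0 : braket v^T v^T != 0 by rewrite braket_eq0 trmx_eq0.
pose n := sqrtc (braket v^T v^T).
have n_ge0 : 0 <= n by rewrite sqrtc_ge0 braket_ge0.
have nJ : conjc n = n.
  by rewrite -(RRe_real (ger0_real n_ge0)) conjc_real.
exists (n^-1 *: v^T); split; last by rewrite -scalemxAr Av scaler0.
rewrite braketZl braketZr fmorphV /= nJ mulrA -invfM -expr2 /n sqr_sqrtc.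
by rewrite mulVf.
Qed.

Lemma exists_orthogonal_unit3 u v w : (3 < d)%N ->
  exists n, [/\ braket n n = 1, braket u n = 0, braket v n = 0 & braket w n = 0].
Proof.
pose row3 i : ket R d := if i is 0 then u else if i is 1 then v else w.
case/(exists_orthogonal_unit (\matrix_(i < 3, j < d) conjc (row3 i j 0))) => n [n1 An].
exists n; split=> //.
- have /matrixP/(_ ord0 ord0) := An; rewrite !mxE => <-.
  by apply: eq_bigr => i _; rewrite !mxE.
- have /matrixP/(_ 1 ord0) := An; rewrite !mxE => <-.
  by apply: eq_bigr => i _; rewrite !mxE.
- have /matrixP/(_ (inord 2) ord0) := An; rewrite !mxE => <-.
  by apply: eq_bigr => i _; rewrite !mxE inordK.
Qed.

(* The point [g] lies on the Thales sphere over the segment from 0 to [psi],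
   i.e. [g = (psi + h) / 2] with [h] a unit vector and [<psi|h>] real.
   The remaining two equations prescribe [<a|h>] and [<b|h>]; the hypothesis
   says that the shortest such [h] has norm at most 1, and a component
   orthogonal to [psi], [a] and [b] makes up for the rest. *)
Lemma exists_thales_point psi a b : (3 < d)%N ->
  pure_state psi -> pure_state a -> pure_state b ->
  let x1 := sqmod (braket a psi) in
  let x2 := sqmod (braket b psi) in
  let x3 := sqmod (braket a b) in
  x1 + x2 + x3 < 1 -> 4 * x1 * x2 * x3 <= (1 - x1 - x2 - x3) ^+ 2 ->
  exists g, [/\ braket a g = 0, braket b g = braket b psi
    & braket g psi = braket g g].
Proof.
move=> d3 psi1 a1 b1 x1 x2 x3 S1 hS.
have x1_ge0 : 0 <= x1 := sqmod_ge0 _.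
have x2_ge0 : 0 <= x2 := sqmod_ge0 _.
have x3_ge0 : 0 <= x3 := sqmod_ge0 _.
set al := braket a psi in x1 x1_ge0 S1 hS.
set be := braket b psi in x2 x2_ge0 S1 hS.
set c := braket a b in x3 x3_ge0 S1 hS.
have al2 : conjc al * al = x1%:C%C by rewrite sqmodE.
have be2 : conjc be * be = x2%:C%C by rewrite sqmodE.
have c2 : conjc c * c = x3%:C%C by rewrite sqmodE.
(* The triple product [<psi|a><a|b><b|psi>]. Its real part enters the Gram determinant [G]; its
   imaginary part is what the [w]-component of [h] has to compensate. *)
pose tau := conjc al * c * be.
pose r := complex.Re tau; pose m := complex.Im tau.
have rm : r ^+ 2 + m ^+ 2 = x1 * x2 * x3.
  have -> : r ^+ 2 + m ^+ 2 = sqmod tau by [].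
  by rewrite !sqmodM sqmod_conjc -/x1 -/x2 -/x3; ring.
have tauD : tau + conjc tau = (2 * r)%:C%C by rewrite addcJ rmorphM rmorph_nat.
have tauB : tau - conjc tau = 2 * m%:C%C * 'i%C by rewrite subcJ.
have tauJ : conjc tau = al * conjc c * conjc be by rewrite !rmorphM /= conjcK.
(* [G] is the Gram determinant of [psi], [a], [b], and [w] below is [D] times
   the component of [psi] orthogonal to [a] and [b]. *)
pose D := 1 - x3; pose G := 1 - x1 - x2 - x3 + 2 * r.
have D0 : 0 < D by rewrite /D; lra.
(* With [S = 1 - x1 - x2 - x3] and [r^2 + m^2 = x1 x2 x3], the hypothesis reads
   [4 m^2 <= S^2 - 4 r^2 = (S - 2r)(S + 2r)], and [S + 2r = G]. The two factors add up to [2S > 0],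
   so [G] cannot be negative. *)
have G_ge : 4 * m ^+ 2 <= (1 - x1 - x2 - x3 - 2 * r) * G by rewrite /G; nra.
have S_gt : 0 < 1 - x1 - x2 - x3 by lra.
have Gm : G = 0 -> m = 0.
  by move=> G0; move: G_ge; rewrite G0 mulr0 => /[dup]; nra.
have G0 : 0 <= G.
  rewrite leNgt; apply/negP => Gneg.
  have : 0 < 1 - x1 - x2 - x3 - 2 * r by move: Gneg; rewrite /G; lra.
  by move=> H; have := sqr_ge0 m; nra.
(* The squared norm of the shortest [h]: the first term comes from the span of [a] and [b], the
   second from the direction [w]. If [G = 0], then [m = 0] and the second term vanishes. *)
pose N := (x1 + x2 + 2 * r) / D + 4 * m ^+ 2 / (D * G).
have N1 : N <= 1.
  have [G00|Gn0] := eqVneq G 0.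
    rewrite /N (Gm G00) expr0n /= mulr0 mul0r addr0 ler_pdivrMr // mul1r.
    by move: G00; rewrite /G /D; lra.
  have Gp : 0 < G by rewrite lt_neqAle eq_sym Gn0.
  have -> : N = (x1 + x2 + 2 * r + 4 * m ^+ 2 / G) / D.
    by rewrite /N; field; rewrite !gt_eqF.
  have : 4 * m ^+ 2 / G <= 1 - x1 - x2 - x3 - 2 * r by rewrite ler_pdivrMr.
  by move=> ?; rewrite ler_pdivrMr// mul1r /D; lra.
pose rho := (Num.sqrt (1 - N))%:C%C : C.
have rho2 : conjc rho * rho = 1 - N%:C%C.
  by rewrite conjc_real -rmorphM -expr2 sqr_sqrtr ?subr_ge0// rmorphB rmorph1.
have [u [u1 ua ub upsi]] := exists_orthogonal_unit3 a b psi d3.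
have Dc : D%:C%C = 1 - conjc c * c by rewrite c2 rmorphB rmorph1.
have Dn0 : D%:C%C != 0 :> C by rewrite fmorph_eq0 gt_eqF.
have abE : braket b a = conjc c by rewrite braketC.
have psia : braket psi a = conjc al by rewrite braketC.
have psib : braket psi b = conjc be by rewrite braketC.
(* Cramer's rule: [D^-1 (s a + t b)] is the vector in the span of [a] and [b] whose overlaps with
   them are [- al] and [be], the values that [<a|g> = 0] and [<b|g> = <b|psi>] demand of [h]. *)
pose s := - (al + c * be); pose t := be + conjc c * al.
pose w := D%:C%C *: psi - (al - c * be) *: a - (be - conjc c * al) *: b.
have aw : braket a w = 0.
  by rewrite !braketBr !braketZr a1 -/al -/c Dc; ring.
have bw : braket b w = 0.
  by rewrite !braketBr !braketZr b1 -/be abE Dc; ring.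
have psiw : braket psi w = G%:C%C.
  rewrite !braketBr !braketZr psi1 psia psib.
  have -> : G%:C%C = D%:C%C - x1%:C%C - x2%:C%C + (tau + conjc tau).
    by rewrite tauD -!rmorphB -rmorphD; congr (_%:C%C); rewrite /G /D; ring.
  by rewrite -al2 -be2 tauJ /tau; ring.
have ww : braket w w = (D * G)%:C%C.
  rewrite {2}/w !braketBr !braketZr -(braketC a) -(braketC b) -(braketC psi).
  by rewrite aw bw psiw conjc0 conjc_real rmorphM; ring.
have uw : braket u w = 0.
  rewrite /w !braketBr !braketZr -(braketC a) -(braketC b) -(braketC psi).
  by rewrite ua ub upsi conjc0; ring.
clearbody w.
(* The [w]-component makes [<psi|h>] real; if [G = 0] it is not needed, and
   [kap = 0] by the convention on division. *)
pose kap := (2 * m / (D * G))%:C%C * 'i%C : C.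
have kapG : kap * G%:C%C = (D^-1)%:C%C * (tau - conjc tau).
  rewrite tauB /kap mulrAC -rmorphM !mulrA -(rmorph_nat (real_complex R)) -!rmorphM.
  congr (_%:C%C * _).
  have [G00|Gn0] := eqVneq G 0; first by rewrite (Gm G00) G00; ring.
  by field; rewrite Gn0 gt_eqF.
have kap2 : conjc kap * kap * (D * G)%:C%C = (4 * m ^+ 2 / (D * G))%:C%C.
  have -> : conjc kap * kap = ((2 * m / (D * G)) ^+ 2)%:C%C.
    by rewrite sqmodE sqmodM /sqmod /=; congr (_%:C%C); ring.
  rewrite -rmorphM; congr (_%:C%C).
  have [G00|Gn0] := eqVneq G 0; first by rewrite (Gm G00) G00; ring.
  by field; rewrite Gn0 gt_eqF.
pose h := (D^-1)%:C%C *: (s *: a + t *: b) + kap *: w + rho *: u.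
have ah : braket a h = - al.
  rewrite /h !braketDr !braketZr !braketDr !braketZr aw ua a1 -/c fmorphV /s /t.
  by apply: (mulfI Dn0); rewrite !mulr0 !addr0 mulVKf// Dc; ring.
have bh : braket b h = be.
  rewrite /h !braketDr !braketZr !braketDr !braketZr bw ub b1 abE fmorphV /s /t.
  by apply: (mulfI Dn0); rewrite !mulr0 !addr0 mulVKf// Dc; ring.
have wh : braket w h = kap * (D * G)%:C%C.
  rewrite /h !braketDr !braketZr !braketDr !braketZr ww.
  rewrite -(braketC a) -(braketC b) -(braketC u) aw bw uw conjc0; ring.
have uh : braket u h = rho.
  rewrite /h !braketDr !braketZr !braketDr !braketZr uw u1.
  rewrite -(braketC a) -(braketC b) ua ub conjc0; ring.
have psih : braket psi h = ((x2 - x1) / D)%:C%C.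
  rewrite /h !braketDr !braketZr !braketDr !braketZr psiw upsi kapG psia psib.
  have -> : ((x2 - x1) / D)%:C%C = (x2%:C%C - x1%:C%C) * (D^-1)%:C%C :> C.
    by rewrite rmorphM rmorphB.
  by rewrite -al2 -be2 tauJ /tau /s /t; ring.
have hh : braket h h = 1.
  rewrite {1}/h !braketDl !braketZl !braketDl !braketZl ah bh wh uh rho2.
  rewrite conjc_real mulrA kap2.
  have -> : N%:C%C = (D^-1)%:C%C * (x1%:C%C + x2%:C%C + (2 * r)%:C%C)
                     + (4 * m ^+ 2 / (D * G))%:C%C :> C.
    by rewrite /N (mulrC (x1 + x2 + 2 * r)) !(rmorphD, rmorphM).
  rewrite -tauD -al2 -be2 tauJ /tau /s /t.
  rewrite rmorphN !rmorphD !rmorphM /= conjcK; ring.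
have hpsi : braket h psi = ((x2 - x1) / D)%:C%C by rewrite -braketC psih conjc_real.
clearbody h.
have n2 : 2 != 0 :> C by rewrite pnatr_eq0.
exists (2^-1 *: (psi + h)); split.
- by rewrite braketZr braketDr ah -/al; ring.
- by rewrite braketZr braketDr bh -/be; field.
- have c12 : conjc 2^-1 = 2^-1 :> C by rewrite fmorphV rmorph_nat.
  by rewrite !braketZl braketZr !braketDl !braketDr c12 psi1 hh hpsi psih; field.
Qed.
End Braket.

(** * From a Thales point to an excluding measurement *)

Section Antidist.
Variables (R : realType) (d : nat).
Local Notation C := (R[i]).
Implicit Types (u v w g psi a b : ket R d) (c : C).

(* For [g = 0] this is the zero matrix, since [0^-1 = 0]. *)
Definition line_proj g : 'M[C]_d :=
  (braket g g)^-1 *: (g *m (map_mx conjc g)^T).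

Lemma line_projE g v : line_proj g *m v = ((braket g g)^-1 * braket g v) *: g.
Proof.
rewrite -scalemxAl -mulmxA -scalerA; congr (_ *: _).
rewrite [(_ ^T *m v)]mx11_scalar -braket_mxE.
by rewrite -[in RHS](mul_mx_scalar).
Qed.

Lemma line_proj_orth_projector g : orth_projector (line_proj g).
Proof.
split.
  apply/matrixP => i j; rewrite !mxE !big_ord1 !mxE !rmorphM /= conjcK.
  by rewrite fmorphV /= braketC; congr (_ * _); rewrite mulrC.
rewrite {2}/line_proj -scalemxAr mulmxA line_projE -scalemxAl scalerA.
have [/eqP g0|g0] := eqVneq (braket g g) 0.
  by rewrite /line_proj (eqP g0) invr0 !mul0r !scale0r.
by rewrite mulVf// mulr1.
Qed.

Lemma line_proj_orthogonal g v : braket g v = 0 -> line_proj g *m line_proj v = 0.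
Proof.
move=> gv.
by rewrite {2}/line_proj -scalemxAr mulmxA line_projE gv mulr0 scale0r mul0mx scaler0.
Qed.

Lemma adjB (A B : 'M[C]_d) : adj (A - B) = adj A - adj B.
Proof. by apply/matrixP => i j; rewrite !mxE rmorphB. Qed.

Lemma adj1 : adj 1%:M = 1%:M :> 'M[C]_d.
Proof. by apply/matrixP => i j; rewrite !mxE rmorph_nat eq_sym. Qed.

Lemma qprob_eq0 (P : 'M[C]_d) psi : P *m psi = 0 -> qprob P psi = 0.
Proof. by rewrite /qprob -mulmxA => ->; rewrite mulmx0 mxE. Qed.

(** The vectors [g] and [k = psi - g] are orthogonal with sum [psi]. The projectors onto their lines
    exclude [a] and [b] respectively, and the complementary projector kills [psi]. *)
Lemma thales_point_antidistinguishable psi a b g :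
  braket a g = 0 -> braket b g = braket b psi -> braket g psi = braket g g ->
  antidistinguishable psi a b.
Proof.
move=> ag bg gpsi; pose k := psi - g.
have gk : braket g k = 0 by rewrite braketBr gpsi subrr.
have kg : braket k g = 0 by rewrite -braketC gk conjc0.
have bk : braket b k = 0 by rewrite braketBr bg subrr.
have kpsi : braket k psi = braket k k by rewrite [RHS]braketBr kg subr0.
have Pg := line_proj_orth_projector g; have Pk := line_proj_orth_projector k.
pose P (f : 'I_3) := if val f is 0 then 1%:M - line_proj g - line_proj k
  else if val f is 1 then line_proj g else line_proj k.
have projP f : orth_projector (P f).
  rewrite /P; case: (val f) => [|[|_]] //.
  case: Pg Pk => [ag' gg] [ak' kk].
  split; first by rewrite !adjB adj1 ag' ak'.
  rewrite !mulmxBl !mul1mx !mulmxBr !mulmx1 gg kk.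
  by rewrite !line_proj_orthogonal// !subr0 !subrr !subr0.
have sumP : \sum_f P f = 1%:M.
  rewrite !big_ord_recl big_ord0 /P /= addr0 [line_proj g + _]addrC.
  by rewrite addrA subrK subrK.
exists (ProjMeas projP sumP) => -[[|[|[|//]]] f3] /=; rewrite /P /=.
- left; apply: qprob_eq0; rewrite !mulmxBl mul1mx !line_projE gpsi kpsi.
  have nz v : (braket v v)^-1 * braket v v *: v = v.
    have [/eqP|v0] := eqVneq (braket v v) 0; last by rewrite mulVf// scale1r.
    by rewrite braket_eq0 => /eqP ->; rewrite scaler0.
  by rewrite !nz -/k subrr.
- right; left; apply: qprob_eq0.
  by rewrite line_projE -(braketC a) ag conjc0 mulr0 scale0r.
- right; right; apply: qprob_eq0.
  by rewrite line_projE -(braketC b) bk conjc0 mulr0 scale0r.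
Qed.

(** The criterion of Caves, Fuchs and Schack. The bound on [d] leaves room for a unit vector
    orthogonal to all three states. *)
Lemma antidistinguishable_overlaps psi a b : (3 < d)%N ->
  pure_state psi -> pure_state a -> pure_state b ->
  let x1 := sqmod (braket a psi) in
  let x2 := sqmod (braket b psi) in
  let x3 := sqmod (braket a b) in
  x1 + x2 + x3 < 1 -> 4 * x1 * x2 * x3 <= (1 - x1 - x2 - x3) ^+ 2 ->
  antidistinguishable psi a b.
Proof.
move=> d3 psi1 a1 b1 x1 x2 x3 S1 hS.
have [g [ag bg gpsi]] := exists_thales_point d3 psi1 a1 b1 S1 hS.
exact: thales_point_antidistinguishable ag bg gpsi.
Qed.
End Antidist.

(** * Additive characters and quadratic phases on finite fields *)

Section Characters.
Variable R : realType.
Local Notation C := (R[i]).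

Definition unit_modulus (F : finFieldType) (f : F -> C) : Prop :=
  forall x, conjc (f x) * f x = 1.

Definition additive_char (F : finFieldType) (chi : F -> C) : Prop :=
  unit_modulus chi /\ forall x y, chi (x + y) = chi x * chi y.

(** A quadratic form in multiplicative notation, given through its polarisation, so that
    characteristic 2, where [a x^2 / 2] makes no sense, is covered as well. *)
Definition quadratic_phase (F : finFieldType) (chi : F -> C) (a : F) (f : F -> C) : Prop :=
  unit_modulus f /\ forall x y, f (x + y) = f x * f y * chi (a * x * y).

Lemma unit_modulus_neq0 (F : finFieldType) (f : F -> C) x : unit_modulus f -> f x != 0.
Proof.
by move=> /(_ x) fx; apply/eqP => f0; move/eqP: fx; rewrite f0 mulr0 eq_sym oner_eq0.
Qed.

Lemma additive_char0 (F : finFieldType) (chi : F -> C) : additive_char chi -> chi 0 = 1.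
Proof.
case=> u m; have := m 0 0; rewrite addr0 => /eqP.
by rewrite -[X in X == _]mulr1 (can_eq (mulKf (unit_modulus_neq0 0 u))) => /eqP.
Qed.

(** Translating the summation variable by [x0] multiplies the sum by [chi x0], which differs from
    1. *)
Lemma sum_additive_char (F : finFieldType) (chi : F -> C) x0 :
  additive_char chi -> chi x0 != 1 -> \sum_x chi x = 0.
Proof.
move=> [u m] n1.
have : \sum_x chi x = chi x0 * \sum_x chi x.
  rewrite mulr_sumr (reindex_inj (addrI x0)); apply: eq_bigr => x _; exact: m.
move/eqP; rewrite -subr_eq0 -{1}[\sum_x _]mul1r -mulrBl mulf_eq0 subr_eq0 eq_sym.
by rewrite (negbTE n1) => /eqP.
Qed.

(** The modulus of a Gauss sum. In the double sum for its square, shifting [z] by [y] leaves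
    [g z * chi (c y z)]; for [z != 0] the sum over [y] is that of a nontrivial character, and
    [z = 0] contributes [#|F|]. *)
Lemma sqmod_quadratic_sum (F : finFieldType) (chi g : F -> C) (x0 c : F) :
  additive_char chi -> chi x0 != 1 -> c != 0 -> quadratic_phase chi c g ->
  sqmod (\sum_x g x) = #|F|%:R.
Proof.
move=> chiP n1 c0 [gu gm]; have chi0 := additive_char0 chiP.
apply: (@complexI R); rewrite -sqmodE rmorph_sum mulr_suml /=.
transitivity (\sum_y \sum_z g z * chi (c * y * z)).
  apply: eq_bigr => y _; rewrite mulr_sumr (reindex_inj (addrI y)).
  by apply: eq_bigr => z _; rewrite gm !mulrA gu mul1r.
rewrite exchange_big (bigD1 0)//= [X in _ + X]big1 => [|z z0].
  have g0 : g 0 = 1.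
    have := gm 0 0; rewrite addr0 mulr0 chi0 mulr1 => /eqP.
    by rewrite -[X in X == _]mulr1 (can_eq (mulKf (unit_modulus_neq0 0 gu))) => /eqP.
  under eq_bigr => y _ do rewrite g0 mul1r mulr0 chi0.
  by rewrite sumr_const addr0 rmorph_nat.
rewrite -mulr_sumr (@sum_additive_char _ _ (c^-1 * z^-1 * x0)) ?mulr0//.
  case: chiP => u m; split=> [x|x y]; first exact: u.
  by rewrite mulrDr mulrDl m.
have -> : c * (c^-1 * z^-1 * x0) * z = x0 by field; rewrite c0 z0.
by [].
Qed.

(** Take a root of [1 + X + ... + X^(p-1)]; the value of this polynomial at 1 is [p], so the root is
    not 1. *)
Lemma prime_root_of_unity p : prime p ->
  exists z : C, [/\ z ^+ p = 1, z != 1 & conjc z * z = 1].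
Proof.
move=> pp; have p1 := prime_gt1 pp.
pose P : {poly C} := \poly_(i < p) 1.
have sP : size P = p by rewrite size_poly_eq ?oner_eq0.
have /closed_rootP[z] : size P != 1 by rewrite sP neq_ltn p1 orbT.
rewrite /root /P horner_poly => /eqP z0.
have {}z0 : \sum_(i < p) z ^+ i = 0.
  by rewrite -[RHS]z0; apply: eq_bigr => i _; rewrite mul1r.
have zp : z ^+ p = 1 by apply/eqP; rewrite -subr_eq0 subrX1 z0 mulr0 eqxx.
exists z; split=> //.
  apply/eqP => z1; move/eqP: z0; rewrite z1 (eq_bigr (fun=> 1)) => [|i _]; last by rewrite expr1n.
  by rewrite sumr_const card_ord pnatr_eq0 -leqn0 leqNgt prime_gt0.
rewrite mulrC -sqr_normc; apply/eqP; rewrite sqrp_eq1//.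
by rewrite -(@pexpr_eq1 _ _ p) ?prime_gt0// -normrX zp normr1.
Qed.

(** Over its prime field, [F] is a vector space. Raising a [p]-th root of unity to the first
    coordinate gives a character, nontrivial at the first basis vector. *)
Lemma exists_linear_char p (F : finFieldType) : p \in [pchar F] ->
  exists (chi : F -> C) (x0 : F), additive_char chi /\ chi x0 != 1.
Proof.
move=> pF; have pp := pcharf_prime pF; have [z [zp z1 zu]] := prime_root_of_unity pp.
pose L := pPrimeCharType pF; pose n := \dim {: L}.
have n0 : (0 < n)%N by rewrite adim_gt0.
pose i0 : 'I_n := Ordinal n0.
pose l (x : F) : 'F_p := coord (vbasis {: L}) i0 (x : L).
have lD x y : l (x + y) = l x + l y by rewrite /l -linearD.
have zD (u v : 'F_p) : z ^+ (u + v)%R = z ^+ u * z ^+ v.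
  by rewrite -exprD -(natr_Zp u) -(natr_Zp v) -natrD !val_Fp_nat// !expr_mod// !exprD !expr_mod.
exists (fun x => z ^+ l x), (vbasis {: L})`_i0; split; last first.
  by rewrite /l coord_free ?(basis_free (vbasisP _))// eqxx.
split=> [x|x y]; last by rewrite lD zD.
by rewrite rmorphXn /= -exprMn zu expr1n.
Qed.

Lemma odd_quadratic_phase (F : finFieldType) (chi : F -> C) a :
  additive_char chi -> (2 : F) != 0 -> exists f, quadratic_phase chi a f.
Proof.
move=> [u m] two; exists (fun x => chi (a * x * x / 2)); split=> [x|x y]; first exact: u.
by rewrite -!m; congr chi; field.
Qed.

(** * Symmetric integer forms and powers of the imaginary unit *)

Section EvenPhase.
Variables (n : nat) (A : 'I_n -> 'I_n -> nat).
Implicit Types U V W : 'I_n -> nat.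

(** The coefficients are natural numbers rather than residues modulo 2, because the values on the
    diagonal matter modulo 4. *)
Definition nat_form U V := (\sum_i \sum_j U i * A i j * V j)%N.

Lemma nat_formDl U V W :
  nat_form (fun i => U i + V i)%N W = (nat_form U W + nat_form V W)%N.
Proof.
rewrite /nat_form -big_split; apply: eq_bigr => i _ /=.
by rewrite -big_split; apply: eq_bigr => j _ /=; rewrite !mulnDl.
Qed.

Hypothesis A_sym : forall i j, A i j = A j i.

Lemma nat_formC U V : nat_form U V = nat_form V U.
Proof.
rewrite /nat_form exchange_big; apply: eq_bigr => j _; apply: eq_bigr => i _.
by rewrite A_sym mulnC (mulnC (U i)) mulnA.
Qed.

Lemma nat_formDr U V W :
  nat_form W (fun i => U i + V i)%N = (nat_form W U + nat_form W V)%N.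
Proof. by rewrite nat_formC nat_formDl !(nat_formC W). Qed.

(* The diagonal of a symmetric form, taken modulo 4, only depends on its
   argument modulo 2. *)
Lemma expi_nat_form U V Z W :
  (forall i, U i + V i = Z i + (W i + W i))%N ->
  'i%C ^+ nat_form Z Z =
  'i%C ^+ nat_form U U * 'i%C ^+ nat_form V V * (-1) ^+ nat_form U V :> C.
Proof.
move=> UV; rewrite -sqr_i -exprM -!exprD.
have -> : (nat_form U U + nat_form V V + 2 * nat_form U V)%N
  = nat_form (fun i => U i + V i)%N (fun i => U i + V i)%N.
  by rewrite nat_formDl !nat_formDr (nat_formC V U); lia.
have -> : (fun i => U i + V i)%N = (fun i => Z i + (W i + W i))%N by apply/funext.
have -> : nat_form (fun i => Z i + (W i + W i))%N (fun i => Z i + (W i + W i))%N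
  = (nat_form Z Z + 4 * (nat_form Z W + nat_form W W))%N.
  by rewrite !(nat_formDl, nat_formDr) (nat_formC W Z); lia.
have i4 : 'i%C ^+ 4 = 1 :> C by rewrite (exprM _ 2 2) sqr_i sqrrN expr1n.
by rewrite exprD exprM i4 expr1n mulr1.
Qed.
End EvenPhase.

Lemma additive_char_sum (F : finFieldType) (chi : F -> C) I (s : seq I) (t : I -> F) :
  additive_char chi -> chi (\sum_(i <- s) t i) = \prod_(i <- s) chi (t i).
Proof.
by move=> chiP; apply: big_morph => [x y|]; [case: chiP | exact: additive_char0].
Qed.

Lemma additive_charMn (F : finFieldType) (chi : F -> C) (x : F) k :
  additive_char chi -> chi (x *+ k) = chi x ^+ k.
Proof.
move=> chiP; elim: k => [|k IH]; first by rewrite mulr0n expr0 additive_char0.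
by rewrite mulrSr exprSr -IH; case: chiP => _ ->.
Qed.

(** In characteristic 2, [chi] takes the values 1 and -1 only, so [chi (a x y)] is -1 to the power
    of a symmetric form. Raising the imaginary unit to the diagonal of that form, on coordinates
    lifted to 0 and 1, gives the phase. *)
Lemma even_quadratic_phase (F : finFieldType) (chi : F -> C) a :
  additive_char chi -> 2 \in [pchar F] -> exists f, quadratic_phase chi a f.
Proof.
move=> chiP F2; pose L := pPrimeCharType F2; pose n := \dim {: L}.
pose b (i : 'I_n) : F := (vbasis {: L})`_i.
pose X (x : F) (i : 'I_n) : nat := coord (vbasis {: L}) i (x : L).
have XE x : x = \sum_i b i *+ X x i.
  rewrite {1}(coord_vbasis (memvf (x : L))); apply: eq_bigr => i _.
  by rewrite -[LHS]/(_%:R * _) mulr_natl.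
(* Addition of the coordinates, with the carry made explicit. *)
have XD x y i : (X x i + X y i = X (x + y)%R i + (X x i * X y i + X x i * X y i))%N.
  rewrite /X -[x + y]/((x : L) + (y : L)) linearD /=.
  move: (coord _ i (x : L)) (coord _ i (y : L)) => u v.
  rewrite -[X in _ = (X + _)%N]/((u + v) %% 2)%N.
  by case: u v => [[|[|?]] ?] [[|[|?]] ?].
(* The truth value, read as 0 or 1, is the exponent of the sign [chi (a * b i * b j)]. *)
pose A i j : nat := chi (a * b i * b j) != 1.
have A_sym i j : A i j = A j i by rewrite /A mulrAC.
have chiA i j : chi (a * b i * b j) = (-1) ^+ A i j.
  have : chi (a * b i * b j) ^+ 2 == 1.
    by rewrite -additive_charMn// -mulr_natr pcharf0// mulr0 additive_char0.
  rewrite sqrf_eq1 /A; case: eqP => [->//|_] /= /eqP ->; by rewrite expr1.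
have chiB x y : chi (a * x * y) = (-1) ^+ nat_form A (X x) (X y).
  rewrite {1}(XE x) {1}(XE y) -mulrA mulr_suml mulr_sumr additive_char_sum//.
  rewrite /nat_form expr_sum; apply: eq_bigr => i _.
  rewrite mulrA mulr_sumr additive_char_sum// expr_sum; apply: eq_bigr => j _.
  rewrite !(mulrnAr, mulrnAl) -mulrnA additive_charMn// chiA -exprM.
  by congr (_ ^+ _); lia.
exists (fun x => 'i%C ^+ nat_form A (X x) (X x)); split=> [x|x y].
  by rewrite rmorphXn -exprMn sqmodE /sqmod /= expr0n expr1n add0r expr1n.
by rewrite chiB; apply: expi_nat_form => // i; exact: XD.
Qed.

Lemma exists_quadratic_phases p e : prime p -> (0 < e)%N ->
  exists (F : finFieldType) (chi : F -> C) (x0 : F) (f : F -> F -> C),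
  [/\ #|F| = (p ^ e)%N, additive_char chi, chi x0 != 1
    & forall a, quadratic_phase chi a (f a)].
Proof.
move=> pp e0; have [F pF cF] := pPrimePowerField pp e0.
have [chi [x0 [chiP n1]]] := exists_linear_char pF.
have phase a : exists f, quadratic_phase chi a f.
  have [p2|p2] := eqVneq p 2; first by apply: even_quadratic_phase; rewrite // -p2.
  apply: odd_quadratic_phase => //; rewrite -(dvdn_pcharf pF).
  by rewrite dvdn_prime2// .
have [f fP] := boolp.choice phase.
by exists F, chi, x0, f.
Qed.
End Characters.

(** * Classical overlaps with pairwise antidistinguishable states *)

Section Overlap.
Context {R : realType} {d0 : measure_display} {T : measurableType d0}.
Variable lam : {measure set T -> \bar R}.

(** The largest term is at most [m], and every other term equals its minimum with the largest one,
    hence occurs among the pairs. *)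
Lemma sum_le_bound_plus_pairs (I : finType) (c : I -> R) (m : R) :
  (forall i, 0 <= c i) -> (forall i, c i <= m) -> 0 <= m ->
  \sum_i c i <= m + \sum_i \sum_(j | j != i) Num.min (c i) (c j).
Proof.
move=> c0 cm m0.
have [i0|noI] := pickP I; last first.
  by rewrite !big_pred0 ?addr0.
case: (Order.TotalTheory.arg_maxP c (erefl : xpredT i0)) => i _ imax.
rewrite (bigD1 i)//= lerD// [leRHS](bigD1 i)//= ler_wpDr//.
  by apply: sumr_ge0 => k _; apply: sumr_ge0 => j _; rewrite le_min !c0.
by apply: ler_sum => j _; rewrite le_min lexx andbT; exact: imax.
Qed.


Variable d : nat.
Variables (mu : ket R d -> T -> R)
  (xi : forall M : proj_meas R d, 'I_(pm_n M) -> T -> R).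
Hypothesis model : reproduces_QM lam mu xi.

Local Open Scope ereal_scope.

(** Split the integrand by the response functions, which sum to 1. On outcome [f] it is at most
    [xi f] times the density of the state that [f] excludes, and this integrates to 0 by the Born
    rule. *)
Lemma antidistinguishable_overlap (psi a b : ket R d) :
  pure_state psi -> pure_state a -> pure_state b ->
  antidistinguishable psi a b ->
  \int[lam]_x (Num.min (Num.min (mu psi x) (mu a x))
                       (Num.min (mu psi x) (mu b x)))%:E = 0.
Proof.
case: model => dens [mxi [xi0 [xi1 born]]] psi1 a1 b1 [M excl].
have mmu v : pure_state v -> measurable_fun setT (mu v) by case/dens.
have mu0 v x : pure_state v -> (0 <= mu v x)%R by case/dens => _ [+ _]; apply.
pose F x := Num.min (Num.min (mu psi x) (mu a x)) (Num.min (mu psi x) (mu b x)).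
have mF : measurable_fun setT F.
  by apply: measurable_minr; apply: measurable_minr; exact: mmu.
have F0 x : (0 <= F x)%R by rewrite !le_min !mu0.
rewrite -[LHS]/(\int[lam]_x (F x)%:E).
have FE x : (F x)%:E = \sum_(f < pm_n M) (xi f x * F x)%:E.
  by rewrite sumEFin -mulr_suml xi1 mul1r.
under eq_integral => x _ do rewrite FE.
rewrite ge0_integral_sum//; last 2 first.
  by move=> f; apply/measurable_EFinP; exact: measurable_funM.
  by move=> f x _; rewrite lee_fin mulr_ge0.
rewrite big1// => f _.
have excl_le v : pure_state v -> (forall x, F x <= mu v x)%R ->
    qprob (pm_P f) v = 0%R -> \int[lam]_x (xi f x * F x)%:E = 0.
  move=> v1 Fv fv; apply/eqP; rewrite eq_le; apply/andP; split; last first.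
    by apply: integral_ge0 => x _; rewrite lee_fin mulr_ge0.
  apply: (@le_trans _ _ (\int[lam]_x (xi f x * mu v x)%:E)); last first.
    by rewrite born// fv.
  apply: ge0_le_integral => //.
  - by move=> x _; rewrite lee_fin mulr_ge0.
  - by apply/measurable_EFinP; exact: measurable_funM.
  - by apply/measurable_EFinP; apply: measurable_funM => //; exact: mmu.
  - by move=> x _; rewrite lee_fin ler_wpM2l.
case: (excl f) => [|[]]; apply: excl_le => // x; rewrite /F !ge_min lexx ?orbT//.
Qed.

(** Pointwise, the sum of the minima [c i] is at most [mu psi] plus the pairwise minima of the
    [c i]. The former integrates to 1 and each of the latter to 0. *)
Lemma sum_omegaC_le1 (I : finType) (psi : ket R d) (e : I -> ket R d) :
  pure_state psi -> (forall i, pure_state (e i)) ->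
  (forall i j, j != i -> antidistinguishable psi (e i) (e j)) ->
  \sum_i omegaC lam (mu psi) (mu (e i)) <= 1.
Proof.
move=> psi1 e1 anti.
have dens v : pure_state v -> is_density lam (mu v) by move=> v1; apply: (proj1 model).
have mmu v : pure_state v -> measurable_fun setT (mu v) by case/dens.
have mu0 v x : pure_state v -> (0 <= mu v x)%R by case/dens => _ [+ _]; apply.
pose c i x := Num.min (mu psi x) (mu (e i) x).
have mc i : measurable_fun setT (c i) by apply: measurable_minr; exact: mmu.
have c0 i x : (0 <= c i x)%R by rewrite le_min !mu0.
have -> : \sum_i omegaC lam (mu psi) (mu (e i)) = \int[lam]_x (\sum_i (c i x)%:E).
  rewrite ge0_integral_sum// => [i|i x _]; last by rewrite lee_fin; exact: c0.
  by apply/measurable_EFinP; exact: mc.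
pose pairs x := \sum_i \sum_(j | j != i) (Num.min (c i x) (c j x))%:E.
have mpair i j : measurable_fun setT (fun x => (Num.min (c i x) (c j x))%:E).
  by apply/measurable_EFinP; exact: measurable_minr.
have pair0 i j x : 0 <= (Num.min (c i x) (c j x))%:E by rewrite lee_fin le_min !c0.
have mpairs : measurable_fun setT pairs.
  by apply: emeasurable_sum => i; under eq_fun do rewrite -big_filter; apply: emeasurable_sum.
have pairs0 x : 0 <= pairs x.
  by apply: sume_ge0 => i _; apply: sume_ge0.
have int_pairs : \int[lam]_x pairs x = 0.
  rewrite /pairs ge0_integral_sum//; last 2 first.
    by move=> i; under eq_fun do rewrite -big_filter; apply: emeasurable_sum.
    by move=> i x _; apply: sume_ge0.
  rewrite big1// => i _.
  under eq_integral => x _ do rewrite -big_filter.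
  rewrite ge0_integral_sum// big_filter big1// => j ji.
  by apply: antidistinguishable_overlap => //; exact: anti.
apply: (@le_trans _ _ (\int[lam]_x ((mu psi x)%:E + pairs x))).
  apply: ge0_le_integral => //.
  - by move=> x _; apply: sume_ge0 => i _; rewrite lee_fin; exact: c0.
  - by apply: emeasurable_sum => i; apply/measurable_EFinP; exact: mc.
  - by apply: emeasurable_funD => //; apply/measurable_EFinP; exact: mmu.
  - move=> x _; rewrite sumEFin /pairs.
    under [X in _ + X]eq_bigr => i _ do rewrite sumEFin.
    rewrite sumEFin -EFinD lee_fin.
    apply: (@sum_le_bound_plus_pairs _ (c^~ x)) => [i|i|]; rewrite ?c0 ?mu0//.
    by rewrite ge_min lexx.
rewrite ge0_integralD//; last 2 first.
- by move=> x _; rewrite lee_fin mu0.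
- by apply/measurable_EFinP; exact: mmu.
by rewrite int_pairs adde0; have [_ [_ ->]] := dens _ psi1.
Qed.

End Overlap.

(** * Vectors of mutually unbiased bases indexed by a finite field *)

Section PhaseKets.
Variables (R : realType) (d : nat) (F : finFieldType).
Local Notation C := (R[i]).
Hypothesis Fd : (#|F| <= d)%N.
Implicit Types u v : F -> C.

Let idx (x : F) : 'I_d := widen_ord Fd (enum_rank x).

Let idx_inj : injective idx.
Proof. by move=> x y /(congr1 val) /= /val_inj /enum_rank_inj. Qed.

(** The embedding of functions on [F] along [idx], extended by zero: as [idx] is injective, each
    inner sum has at most one term. *)
Definition fun_ket u : ket R d := \col_i \sum_(x | idx x == i) u x.

Lemma braket_fun_ket u v : braket (fun_ket u) (fun_ket v) = \sum_x conjc (u x) * v x.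
Proof.
rewrite [RHS](partition_big idx xpredT)//=; apply: eq_bigr => i _.
rewrite !mxE rmorph_sum mulr_suml; apply: eq_bigr => x /eqP <-; congr (_ * _).
by rewrite (big_pred1 x) // => y; rewrite (inj_eq idx_inj).
Qed.

Variables (chi : F -> C) (x0 : F) (f : F -> F -> C).
Hypotheses (chiP : additive_char chi) (chi_x0 : chi x0 != 1).
Hypothesis fP : forall a, quadratic_phase chi a (f a).

Let q : R := #|F|%:R.
Let q_gt0 : 0 < q. Proof. by rewrite ltr0n (cardD1 0). Qed.

Definition origin_ket : ket R d := fun_ket (fun x => (x == 0)%:R).

Definition phase (ab : F * F) (x : F) : C := f ab.1 x * chi (ab.2 * x).

Definition phase_ket (ab : F * F) : ket R d :=
  (Num.sqrt q)^-1%:C%C *: fun_ket (phase ab).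

Lemma conj_additive_char x : conjc (chi x) = chi (- x).
Proof.
have [u m] := chiP; apply: (mulIf (unit_modulus_neq0 x u)).
by rewrite u -m addNr additive_char0.
Qed.

Lemma unit_modulus_phase ab : unit_modulus (phase ab).
Proof.
move=> x; rewrite /phase rmorphM /= mulrACA.
by have [fu _] := fP ab.1; have [u _] := chiP; rewrite fu u mulr1.
Qed.

Lemma sqmod_phase ab x : sqmod (phase ab x) = 1.
Proof. by apply: (@complexI R); rewrite -sqmodE unit_modulus_phase. Qed.

Lemma pure_origin_ket : pure_state origin_ket.
Proof.
rewrite /pure_state braket_fun_ket (bigD1 0)//= big1 => [|x /negbTE ->]; last first.
  by rewrite mulr0.
by rewrite eqxx rmorph1 mulr1 addr0.
Qed.

Lemma sqmod_real (x : R) : sqmod x%:C%C = x ^+ 2.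
Proof. by rewrite /sqmod /= expr0n addr0. Qed.

Lemma sqmod_braket_phase_ket ab ab' : sqmod (braket (phase_ket ab) (phase_ket ab')) =
  sqmod (\sum_x conjc (phase ab x) * phase ab' x) / q ^+ 2.
Proof.
rewrite braketZl braketZr braket_fun_ket conjc_real !sqmodM sqmod_real.
by rewrite exprVn sqr_sqrtr ?ltW// mulrA -invfM mulrC.
Qed.

Lemma pure_phase_ket ab : pure_state (phase_ket ab).
Proof.
rewrite /pure_state braketZl braketZr braket_fun_ket conjc_real.
under eq_bigr => x _ do rewrite unit_modulus_phase.
rewrite sumr_const -(rmorph_nat (real_complex R)) -/q -!rmorphM mulrA -invfM.
by rewrite -expr2 sqr_sqrtr ?ltW// mulVf ?gt_eqF.
Qed.

Lemma sqmod_braket_origin ab : sqmod (braket (phase_ket ab) origin_ket) = q^-1.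
Proof.
rewrite braketZl braket_fun_ket conjc_real sqmodM sqmod_real (bigD1 0)//=.
rewrite big1 => [|x /negbTE ->]; last by rewrite mulr0.
by rewrite eqxx mulr1 addr0 sqmod_conjc sqmod_phase mulr1 exprVn sqr_sqrtr ?ltW.
Qed.

(** For equal first indices the summand is a nontrivial character and the sum is 0. Otherwise it is
    a quadratic phase with parameter [a' - a != 0], a Gauss sum of squared modulus [q], to be
    divided by [q^2]. *)
Lemma sqmod_braket_phase_neq ab ab' : ab' != ab ->
  sqmod (braket (phase_ket ab) (phase_ket ab')) \in [:: 0; q^-1].
Proof.
case: ab ab' => [a b] [a' b'] neq; rewrite sqmod_braket_phase_ket !inE.
have [chiu chim] := chiP.
have [aE|na] := eqVneq a' a.
  subst a'; have nb : b' - b != 0.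
    by rewrite subr_eq0; apply: contraNneq neq => ->.
  rewrite (eq_bigr (fun x => chi ((b' - b) * x))) => [|x _]; last first.
    rewrite /phase /= rmorphM /= mulrACA; have [fu _] := fP a.
    by rewrite fu mul1r conj_additive_char -chim; congr chi; ring.
  rewrite (@sum_additive_char _ _ _ ((b' - b)^-1 * x0)).
  - by rewrite /sqmod /= expr0n addr0 mul0r eqxx.
  - by split=> [x|x y]; [exact: chiu | rewrite mulrDr chim].
  - by rewrite mulVKf.
have ca : a' - a != 0 by rewrite subr_eq0.
rewrite (sqmod_quadratic_sum chiP chi_x0 ca) ?orbT//.
  by apply/orP; right; rewrite -/q expr2 invfM mulVKf ?eqxx ?gt_eqF.
have [_ fm] := fP a; have [_ fm'] := fP a'.
split=> [x|x y].
  by rewrite rmorphM /= conjcK mulrACA (mulrC (phase _ _)) !unit_modulus_phase mulr1.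
rewrite /phase /= fm fm' !mulrDr !chim !rmorphM /= !conj_additive_char.
rewrite [chi ((a' - a) * x * y)](_ : _ = chi (- (a * x * y)) * chi (a' * x * y)).
  by ring.
by rewrite -chim; congr chi; ring.
Qed.

Lemma antidistinguishable_phase_kets ab ab' : (4 <= #|F|)%N -> ab' != ab ->
  antidistinguishable origin_ket (phase_ket ab) (phase_ket ab').
Proof.
move=> F4 neq; have q4 : 4 <= q by rewrite ler_nat.
have qV : 0 < q^-1 by rewrite invr_gt0.
have qV4 : q^-1 <= 4^-1 by rewrite lef_pV2 ?posrE.
apply: antidistinguishable_overlaps.
- exact: leq_trans F4 Fd.
- exact: pure_origin_ket.
- exact: pure_phase_ket.
- exact: pure_phase_ket.
- rewrite !sqmod_braket_origin.
  have := sqmod_braket_phase_neq neq; rewrite !inE => /orP[]/eqP ->; lra.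
- rewrite !sqmod_braket_origin.
  have := sqmod_braket_phase_neq neq; rewrite !inE => /orP[]/eqP ->.
    by rewrite mulr0 sqr_ge0.
  (* With all three overlaps equal to [y = 1/q], the criterion becomes [(1 - 3y)^2 - 4y^3 = (1 -
     4y)(1 - y)^2 >= 0]; this is where [q >= 4] is essential. *)
  rewrite -subr_ge0 [X in 0 <= X](_ : _ = (1 - 4 * q^-1) * (1 - q^-1) ^+ 2).
    by rewrite mulr_ge0 ?sqr_ge0//; lra.
  by ring.
Qed.
End PhaseKets.

(** * Numerical bounds on [k] *)

Lemma overlap_bound (R : realType) (d : nat) (d0 : measure_display)
  (T : measurableType d0) (lam : {measure set T -> \bar R})
  (mu : ket R d -> T -> R)
  (xi : forall M : proj_meas R d, 'I_(pm_n M) -> T -> R) (k : R) (p e : nat) :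
  reproduces_QM lam mu xi ->
  (forall psi phi, pure_state psi -> pure_state phi ->
     ((k * omegaQ psi phi)%:E <= omegaC lam (mu psi) (mu phi))%E) ->
  prime p -> (4 <= p ^ e <= d)%N -> k < 2 / (p ^ e)%:R.
Proof.
move=> model hk pp /andP[q4 qd].
have e0 : (0 < e)%N by case: e q4 {qd}.
have [F [chi [x0 [f [cF chiP n1 fP]]]]] := exists_quadratic_phases R pp e0.
rewrite -cF in q4 qd *; set q : R := #|F|%:R.
have q_gt0 : 0 < q by rewrite ltr0n (leq_trans _ q4).
pose psi := origin_ket R qd; pose v := phase_ket qd chi f.
have psi1 : pure_state psi by exact: pure_origin_ket.
have v1 ab : pure_state (v ab) by exact: pure_phase_ket.
have QE ab : omegaQ psi (v ab) = 1 - Num.sqrt (1 - q^-1).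
  by rewrite /omegaQ -braketC sqmod_conjc sqmod_braket_origin.
set w := 1 - Num.sqrt (1 - q^-1) in QE.
have := sum_omegaC_le1 model psi1 v1.
move=> /(_ (fun ab ab' => antidistinguishable_phase_kets qd chiP n1 fP q4)) sum1.
have : (\sum_(ab : F * F) (k * w)%:E <= 1)%E.
  by apply: le_trans sum1; apply: lee_sum => ab _; rewrite -(QE ab) hk.
rewrite sumEFin lee_fin sumr_const card_prod -(mulr_natr (k * w)) natrM -/q => kw.
(* The strictness of the final bound comes from [sqrt (1 - y) < 1 - y / 2] for [y = 1/q]: the
   squares differ by [y^2 / 4]. *)
have w_gt : (2 * q)^-1 < w.
  have q1 : q^-1 < 1 by rewrite invf_lt1// ltr1n (leq_trans _ q4).
  have -> : (2 * q)^-1 = q^-1 / 2 by rewrite invfM mulrC.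
  have qV : 0 < q^-1 by rewrite invr_gt0.
  suff : Num.sqrt (1 - q^-1) < 1 - q^-1 / 2 by rewrite /w; lra.
  have s0 : 0 <= Num.sqrt (1 - q^-1) := sqrtr_ge0 _.
  have s2 : Num.sqrt (1 - q^-1) ^+ 2 = 1 - q^-1 by rewrite sqr_sqrtr ?subr_ge0 ?ltW.
  by rewrite ltNge; apply/negP; nra.
(* If [k >= 2/q], then [k w q^2 >= 2 q w > 1], against the bound [kw] obtained by summing over all
   [q^2] vectors. *)
rewrite ltNge; apply/negP => k_ge; move: kw; rewrite leNgt => /negP; apply.
have w0 : 0 < w by apply: lt_trans w_gt; rewrite invr_gt0 mulr_gt0.
have : 1 < 2 * q * w by move: w_gt; rewrite -[(2 * q)^-1]mul1r ltr_pdivrMr ?mulr_gt0// mulrC.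
move/lt_le_trans; apply.
have -> : 2 * q * w = 2 / q * w * (q * q) by field; rewrite gt_eqF.
by rewrite ler_wpM2r ?mulr_ge0 ?(ltW q_gt0)// ler_wpM2r ?(ltW w0).
Qed.

Unset Implicit Arguments. Set Strict Implicit.

Theorem theorem2 (R : realType) (d : nat) (d0 : measure_display)
  (T : measurableType d0) (lam : {measure set T -> \bar R})
  (mu : ket R d -> T -> R)
  (xi : forall M : proj_meas R d, 'I_(pm_n M) -> T -> R) (k : R) :
  (4 <= d)%N ->
  reproduces_QM lam mu xi ->
  (forall psi phi, pure_state psi -> pure_state phi ->
     ((k * omegaQ psi phi)%:E <= omegaC lam (mu psi) (mu phi))%E) ->
  k < 4 / (d.-1)%:R /\
  ((exists p e : nat, [/\ prime p, (0 < e)%N & d = (p ^ e)%N]) ->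
     k < 2 / d%:R).
Proof.
move=> d4 model hk; split; last first.
  case=> p [e [pp e0 dE]].
  have := @overlap_bound R d d0 T lam mu xi k p e model hk pp.
  by rewrite -dE d4 leqnn; apply.
pose e := trunc_log 2 d; have [ed de] : (2 ^ e <= d)%N /\ (d < 2 ^ e.+1)%N.
  by have /andP[] := trunc_log_bounds (isT : (1 < 2)%N) (leq_trans (isT : (0 < 4)%N) d4).
have e2 : (2 <= e)%N.
  by have : (2 ^ 2 < 2 ^ e.+1)%N := leq_ltn_trans d4 de; rewrite ltn_exp2l.
have e4 : (4 <= 2 ^ e)%N by rewrite -[4%N]/(2 ^ 2)%N leq_exp2l.
have := @overlap_bound R d d0 T lam mu xi k 2 e model hk isT.
rewrite e4 ed => /(_ isT) /lt_le_trans; apply.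
(* The inequality [2 / 2^e <= 4 / (d - 1)] amounts to [d - 1 <= 2^(e+1)], which the choice of [e]
   guarantees. *)
rewrite ler_pdivrMr ?ltr0n ?expn_gt0// mulrAC ler_pdivlMr; last by rewrite ltr0n; lia.
rewrite -!natrM ler_nat; move: de; rewrite expnS; lia.
Qed.
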